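(* Let $(\mathfrak{g},\{\cdot,\cdot,\cdot\},\mu,\epsilon,\alpha,\beta)$ be a noncommutative $3$-BiHom-Poisson color algebra and $T:V\to\mathfrak{g}$ a Kupershmidt operator on $\mathfrak{g}$ with respect to a representation $(V,\rho,\mathfrak{l},\mathfrak{r},\alpha_V,\beta_V)$. Define, for $u,v,w\in\mathcal{H}(V)$, $$\{u,v,w\}_V=\rho(T(u),T(v))w,\qquad u\prec_V v=\epsilon(u,v)\,\mathfrak{r}(T(v))u,\qquad u\succ_V v=\mathfrak{l}(T(u))v.$$ Then $(V,\{\cdot,\cdot,\cdot\}_V,\prec_V,\succ_V,\epsilon,\alpha_V,\beta_V)$ is a noncommutative $3$-BiHom-pre-Poisson color algebra.
   Context: $\mathbb{K}$ is an algebraically closed field of characteristic zero and $\Gamma$ is an abelian group. For a $\Gamma$-graded vector space $V=\bigoplus_{a\in\Gamma}V_a$, $\mathcal{H}(V)$ is the set of homogeneous elements. A linear or multilinear map between graded spaces is even if it has degree zero; a map $\mathfrak{l}:\mathfrak{g}\to End(V)$ or $\rho:\mathfrak{g}\times\mathfrak{g}\to End(V)$ is even if $(x,u)\mapsto\mathfrak{l}(x)u$, resp. $(x,y,u)\mapsto\rho(x,y)u$, is. A skew-symmetric bicharacter is a map $\epsilon:\Gamma\times\Gamma\to\mathbb{K}^*$ with $\epsilon(a,a')\epsilon(a',a)=1$, $\epsilon(a,a'+a'')=\epsilon(a,a')\epsilon(a,a'')$, $\epsilon(a+a',a'')=\epsilon(a,a'')\epsilon(a',a'')$. For homogeneous $x,y,z$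 of degrees $a,b,c$ write $\epsilon(x,y)=\epsilon(a,b)$, $\epsilon(x+y,z)=\epsilon(a+b,c)$, etc. All identities below are for homogeneous elements. BiHom-associative color algebra $(\mathfrak{g},\mu,\epsilon,\alpha,\beta)$: a $\Gamma$-graded space with an even bilinear $\mu$ and even commuting linear maps $\alpha,\beta$ such that $\alpha(\mu(x,y))=\mu(\alpha(x),\alpha(y))$, $\beta(\mu(x,y))=\mu(\beta(x),\beta(y))$, $\mu(\alpha(x),\mu(y,z))=\mu(\mu(x,y),\beta(z))$. $3$-BiHom-Lie color algebra $(\mathfrak{g},[\cdot,\cdot,\cdot],\epsilon,\alpha,\beta)$: a $\Gamma$-graded space with an even trilinear bracket and even linear maps $\alpha,\beta$ such that $[\beta(x),\beta(y),\alpha(z)]=-\epsilon(x,y)[\beta(y),\beta(x),\alpha(z)]$, $[\beta(x),\beta(y),\alpha(z)]=-\epsilon(y,z)[\beta(x),\beta(z),\alpha(y)]$, and $[\beta^2(x),\beta^2(y),[\beta(z),\beta(u),\alpha(v)]]=\epsilon(x+y+z,u+v)[\beta^2(u),\beta^2(v),[\beta(x),\beta(y),\alpha(z)]]-\epsilon(x+y,z+v)\epsilon(u,v)[\beta^2(z),\beta^2(v),[\beta(x),\beta(y),\alpha(u)]]+\epsilon(x+y,z+u)[\beta^2(z),\beta^2(u),[\beta(x),\beta(y),\alpha(v)]]$. Noncommutative $3$-BiHom-Poisson color algebra $(\mathfrak{g},\{\cdot,\cdot,\cdot\},\mu,\epsilon,\alpha,\beta)$: $(\mathfrak{g},\mu,\epsilon,\alpha,\beta)$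 is a BiHom-associative color algebra, $(\mathfrak{g},\{\cdot,\cdot,\cdot\},\epsilon,\alpha,\beta)$ is a $3$-BiHom-Lie color algebra, and $\{\alpha\beta(x),\alpha\beta(y),\mu(z,t)\}=\mu(\{\beta(x),\beta(y),z\},\beta(t))+\epsilon(x+y,z)\mu(\beta(z),\{\alpha(x),\alpha(y),t\})$. Bimodule $(V,\mathfrak{l},\mathfrak{r},\alpha_V,\beta_V)$ of a BiHom-associative color algebra: $V$ is $\Gamma$-graded, $\mathfrak{l},\mathfrak{r}:\mathfrak{g}\to End(V)$ and $\alpha_V,\beta_V:V\to V$ are even linear, $\alpha_V\beta_V=\beta_V\alpha_V$, $\alpha_V(\mathfrak{l}(x)u)=\mathfrak{l}(\alpha(x))\alpha_V(u)$, $\beta_V(\mathfrak{l}(x)u)=\mathfrak{l}(\beta(x))\beta_V(u)$, the same two identities with $\mathfrak{r}$ in place of $\mathfrak{l}$, and $\mathfrak{l}(\alpha(x))\mathfrak{l}(y)v=\mathfrak{l}(\mu(x,y))\beta_V(v)$, $\mathfrak{l}(\alpha(x))\mathfrak{r}(y)v=\epsilon(x,y)\mathfrak{r}(\beta(y))\mathfrak{l}(x)v$, $\mathfrak{r}(\mu(x,y))\alpha_V(v)=\epsilon(x,y)\mathfrak{r}(\beta(y))\mathfrak{r}(x)v$. Representation $(V,\rho,\alpha_V,\beta_V)$ of a $3$-BiHom-Lie color algebra: $\alpha_V,\beta_V$ are commuting even linear maps of $V$ and $\rho:\mathfrak{g}\times\mathfrak{g}\to End(V)$ is even bilinear, $\epsilon$-skew-symmetric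 ($\rho(x,y)=-\epsilon(x,y)\rho(y,x)$), with (1) $\rho(\alpha(u),\alpha(v))\alpha_V=\alpha_V\rho(u,v)$; (2) $\rho(\beta(u),\beta(v))\beta_V=\beta_V\rho(u,v)$; (3) $\rho(\alpha\beta(u),\alpha\beta(v))\rho(x,y)=\epsilon(u+v,x+y)\rho(\beta(x),\beta(y))\rho(\alpha(u),\alpha(v))+\rho([\beta(u),\beta(v),x],\beta(y))\beta_V+\epsilon(u+v,x)\rho(\beta(x),[\beta(u),\beta(v),y])\beta_V$; (4) $\rho([\beta(u),\beta(v),x],\beta(y))\beta_V=\epsilon(u,x+v)\rho(\alpha\beta(v),\beta(x))\rho(\alpha(u),y)+\epsilon(u+v,x)\rho(\beta(x),\alpha\beta(u))\rho(\alpha(v),y)+\rho(\alpha\beta(u),\alpha\beta(v))\rho(x,y)$. Representation $(V,\rho,\mathfrak{l},\mathfrak{r},\alpha_V,\beta_V)$ of a noncommutative $3$-BiHom-Poisson color algebra: $(V,\mathfrak{l},\mathfrak{r},\alpha_V,\beta_V)$ is a bimodule of $(\mathfrak{g},\mu,\epsilon,\alpha,\beta)$, $(V,\rho,\alpha_V,\beta_V)$ is a representation of $(\mathfrak{g},\{\cdot,\cdot,\cdot\},\epsilon,\alpha,\beta)$, and $\rho(\alpha\beta(x),\alpha\beta(y))\mathfrak{l}(z)=\mathfrak{l}(\{\beta(x),\beta(y),z\})\beta_V+\epsilon(x+y,z)\mathfrak{l}(\beta(z))\rho(\alpha(x),\alpha(y))$, $\rho(\alpha\beta(x),\alpha\beta(y))\mathfrak{r}(z)=\epsilon(x+y,z)\mathfrak{r}(\beta(z))\rho(\beta(x),\beta(y))+\mathfrak{r}(\{\alpha(x),\alpha(y),z\})\beta_V$,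 $\rho(\alpha\beta(x),\mu(\beta(y),\beta(z)))\alpha_V^2\beta_V=\epsilon(x+y,z)\mathfrak{r}(\alpha\beta(z))\rho(\beta(x),\beta(y))\alpha_V\beta_V+\epsilon(x,y)\mathfrak{l}(\alpha\beta(y))\rho(\alpha(x),\beta(z))\alpha_V^2$. Kupershmidt operator with respect to such a representation: here $\alpha_V,\beta_V$ are assumed bijective, and $T:V\to\mathfrak{g}$ is an even linear map with $T\alpha_V=\alpha T$, $T\beta_V=\beta T$, $\mu(T(u),T(v))=T(\mathfrak{l}(T(u))v+\epsilon(u,v)\mathfrak{r}(T(v))u)$, and $\{T(u),T(v),T(w)\}=T\big(\rho(T(u),T(v))w-\epsilon(v,w)\rho(T(u),T(\alpha_V^{-1}\beta_V(w)))\alpha_V\beta_V^{-1}(v)+\epsilon(u,v+w)\rho(T(v),T(\alpha_V^{-1}\beta_V(w)))\alpha_V\beta_V^{-1}(u)\big)$. $3$-BiHom-pre-Lie color algebra $(A,\{\cdot,\cdot,\cdot\},\epsilon,\alpha,\beta)$: a $\Gamma$-graded space $A$ with an even trilinear map and commuting bijective even linear maps $\alpha,\beta$ preserving $\{\cdot,\cdot,\cdot\}$ such that, with $[x,y,z]^C=\{x,y,z\}-\epsilon(y,z)\{x,\beta\alpha^{-1}(z),\alpha\beta^{-1}(y)\}+\epsilon(x,y+z)\{y,\beta\alpha^{-1}(z),\alpha\beta^{-1}(x)\}$: (a) $\{\beta(x),\beta(y),\alpha(z)\}=-\epsilon(x,y)\{\beta(y),\beta(x),\alpha(z)\}$; (b)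 $\{\alpha\beta(x_4),\alpha\beta(x_5),\{x_1,x_2,x_3\}\}=\{[\beta(x_4),\beta(x_5),x_1]^C,\beta(x_2),\beta(x_3)\}+\epsilon(x_4+x_5,x_1)\{\beta(x_1),[\beta(x_4),\beta(x_5),x_2]^C,\beta(x_3)\}+\epsilon(x_4+x_5,x_1+x_2)\{\beta(x_1),\beta(x_2),\{\alpha(x_4),\alpha(x_5),x_3\}\}$; (c) $\{[\beta(x_4),\beta(x_5),x_1]^C,\beta(x_2),\beta(x_3)\}=\epsilon(x_4,x_1+x_5)\{\alpha\beta(x_5),\beta(x_1),\{\alpha(x_4),x_2,x_3\}\}+\epsilon(x_4+x_5,x_1)\{\beta(x_1),\alpha\beta(x_4),\{\alpha(x_5),x_2,x_3\}\}+\{\alpha\beta(x_4),\alpha\beta(x_5),\{x_1,x_2,x_3\}\}$. BiHom-dendriform color algebra $(A,\prec,\succ,\epsilon,\alpha,\beta)$: a $\Gamma$-graded space with even bilinear $\prec,\succ$ and commuting even linear maps $\alpha,\beta$ preserving $\prec$ and $\succ$ such that, with $x\cdot y=x\prec y+x\succ y$: $(x\prec y)\prec\beta(z)=\alpha(x)\prec(y\cdot z)$, $(x\succ y)\prec\beta(z)=\alpha(x)\succ(y\prec z)$, $\alpha(x)\succ(y\succ z)=(x\cdot y)\succ\beta(z)$. Noncommutative $3$-BiHom-pre-Poisson color algebra $(A,\{\cdot,\cdot,\cdot\},\prec,\succ,\epsilon,\alpha,\beta)$: a $3$-BiHom-pre-Lie color algebra $(A,\{\cdot,\cdot,\cdot\},\epsilon,\alpha,\beta)$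 and a BiHom-dendriform color algebra $(A,\prec,\succ,\epsilon,\alpha,\beta)$ such that (P1) $\{\alpha\beta^2(x),\alpha\beta^2(y),z\prec\alpha(t)\}-\{\beta^2(x),\beta^2(y),z\}\prec\alpha\beta(t)=\epsilon(x+y,z)\beta(z)\prec\big(\{\alpha\beta(x),\alpha\beta(y),\alpha(t)\}-\epsilon(y,t)\{\alpha\beta(x),\beta(t),\alpha^2(y)\}+\epsilon(x,y+t)\{\alpha\beta(y),\beta(t),\alpha^2(x)\}\big)$; (P2) $\{\alpha\beta(x),\alpha^2\beta(y),\alpha(z)\succ t\}-\epsilon(x+y,z)\alpha\beta(z)\succ\{\alpha(x),\alpha^2(y),t\}=\big(\{\beta(x),\alpha\beta(y),\alpha(z)\}-\epsilon(y,z)\{\beta(x),\beta(z),\alpha^2(y)\}+\epsilon(x,y+z)\{\alpha\beta(y),\beta(z),\alpha(x)\}\big)\succ\beta(t)$; (P3) $\{\alpha\beta(x),\beta(y\prec z),\alpha^2\beta(t)\}+\{\alpha\beta(x),\beta(y\succ z),\alpha^2\beta(t)\}=\epsilon(x,y)\alpha\beta(y)\succ\{\alpha(x),\beta(z),\alpha^2(t)\}+\epsilon(z,t)\{\beta(x),\beta(y),\alpha\beta(t)\}\prec\alpha\beta(z)$. *)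

(* Defs.v *)
From HB Require Import structures.
From mathcomp Require Import all_boot all_order all_algebra.
From mathcomp Require Import boolp classical_sets functions.

Set Implicit Arguments.
Unset Strict Implicit.
Unset Printing Implicit Defensive.

Import GRing.Theory.
Local Open Scope ring_scope.

(* A grading V = (+)_(a : Gamma) V_a by subspaces; a homogeneous element of
   degree a is an element of [gr a].  Identities "for homogeneous elements" are
   stated for all degrees a, b, ... and all x \in gr a, y \in gr b, ... *)
Record grading (K : fieldType) (Gamma : zmodType) (V : lmodType K) := Grading {
  gpart :> Gamma -> {pred V};
  gpart_submod : forall a, submod_closed (gpart a);
  gpart_span : forall v, exists sf : seq Gamma * (Gamma -> V),
    [/\ uniq sf.1, forall a, sf.2 a \in gpart a & v = \sum_(a <- sf.1) sf.2 a];
  gpart_free : forall (s : seq Gamma) (f : Gamma -> V),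
    uniq s -> (forall a, f a \in gpart a) -> \sum_(a <- s) f a = 0 ->
    {in s, forall a, f a = 0}
}.

Record bicharacter (K : fieldType) (Gamma : zmodType) := Bicharacter {
  bichar :> Gamma -> Gamma -> K;
  bichar_neq0 : forall a b, bichar a b != 0;
  bichar_skew : forall a b, bichar a b * bichar b a = 1;
  bicharDr : forall a b c, bichar a (b + c) = bichar a b * bichar a c;
  bicharDl : forall a b c, bichar (a + b) c = bichar a c * bichar b c
}.

Section Components.
Variables (K : fieldType) (Gamma : zmodType) (V : lmodType K).
Variable gr : grading Gamma V.

(* [gsupp v] contains the degrees of all the nonzero components of v, but the
   component [gcomp v a] may be 0 for some a in [gsupp v]. *)
Definition gsupp (v : V) : seq Gamma := (sval (cid (gpart_span gr v))).1.
Definition gcomp (v : V) (a : Gamma) : V :=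
  if a \in gsupp v then (sval (cid (gpart_span gr v))).2 a else 0.

Lemma gcomp_in v a : gcomp v a \in gr a.
Proof.
rewrite /gcomp; case: ifP => _; last by have [] := gpart_submod gr a.
by case: (svalP (cid (gpart_span gr v))).
Qed.

Lemma gsupp_uniq v : uniq (gsupp v).
Proof. by case: (svalP (cid (gpart_span gr v))). Qed.

Lemma gcomp_sum v : v = \sum_(a <- gsupp v) gcomp v a.
Proof.
case: (svalP (cid (gpart_span gr v))) => _ _ {1}->.
by apply: eq_big_seq => a; rewrite /gcomp => ->.
Qed.

Lemma gcomp_hom a v : v \in gr a -> gcomp v =1 fun b => if b == a then v else 0.
Proof.
move=> va b.
have gr0 c : 0 \in gr c by have [] := gpart_submod gr c.
have grL c : linear_closed (gr c) by have [] := gpart_submod gr c.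
set s := undup (a :: gsupp v).
pose f c := gcomp v c - (if c == a then v else 0).
have fin c : f c \in gr c.
  rewrite /f; case: eqP => [->|_]; last by rewrite subr0 gcomp_in.
  by rewrite addrC -scaleN1r; apply: grL => //; exact: gcomp_in.
have us : uniq s by rewrite undup_uniq.
have sum0 : \sum_(c <- s) f c = 0.
  rewrite /f sumrB -[X in _ - X]big_mkcond -[X in _ - X]big_filter.
  rewrite filter_pred1_uniq ?mem_undup ?mem_head//.
  rewrite big_seq1; apply/eqP; rewrite subr_eq0; apply/eqP.
  rewrite [RHS]gcomp_sum (bigID (mem (gsupp v)))/= [X in _ + X]big1; last first.
    by move=> c /negPf cs; rewrite /gcomp cs.
  rewrite addr0 -big_filter; apply: perm_big; apply: uniq_perm.
  - by rewrite filter_uniq.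
  - exact: gsupp_uniq.
  - by move=> c; rewrite mem_filter mem_undup inE; case: (c \in gsupp v); rewrite ?orbT.
have [bs|bs] := boolP (b \in s).
  by have /eqP := gpart_free us fin sum0 bs; rewrite subr_eq0 => /eqP.
move: bs; rewrite mem_undup inE negb_or => /andP[/negPf-> /negPf bs].
by rewrite /gcomp bs.
Qed.

End Components.

Section GradedMaps.
Variables (K : fieldType) (Gamma : zmodType).

Definition even_map (U V : lmodType K) (gU : grading Gamma U)
    (gV : grading Gamma V) (f : U -> V) :=
  forall a x, x \in gU a -> f x \in gV a.

Definition even_bilinear (U V W : lmodType K) (gU : grading Gamma U)
    (gV : grading Gamma V) (gW : grading Gamma W) (f : U -> V -> W) :=
  [/\ forall y, linear (f^~ y), forall x, linear (f x) &
      forall a b x y, x \in gU a -> y \in gV b -> f x y \in gW (a + b)].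

Definition even_trilinear (U V W X : lmodType K) (gU : grading Gamma U)
    (gV : grading Gamma V) (gW : grading Gamma W) (gX : grading Gamma X)
    (f : U -> V -> W -> X) :=
  [/\ forall y z, linear (fun x => f x y z),
      forall x z, linear (fun y => f x y z),
      forall x y, linear (f x y) &
      forall a b c x y z, x \in gU a -> y \in gV b -> z \in gW c ->
        f x y z \in gX (a + b + c)].

(* The bilinear extension of (u, v) |-> eps(u, v) f(u, v), a formula which only
   makes sense for homogeneous u and v. *)
Definition color_ext (V W : lmodType K) (gV : grading Gamma V)
    (eps : bicharacter K Gamma) (f : V -> V -> W) (u v : V) : W :=
  \sum_(a <- gsupp gV u) \sum_(b <- gsupp gV v)
    eps a b *: f (gcomp gV u a) (gcomp gV v b).

Lemma color_ext_hom (V W : lmodType K) (gV : grading Gamma V)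
    (eps : bicharacter K Gamma) (f : V -> V -> W) :
    (forall v, linear (f^~ v)) -> (forall u, linear (f u)) ->
  forall a b u v, u \in gV a -> v \in gV b ->
    color_ext gV eps f u v = eps a b *: f u v.
Proof.
move=> fl fr a b u v ua vb.
have f0l w : f 0 w = 0.
  by have := fl w (- 1) 0 0; rewrite scaler0 add0r scaleN1r addNr.
have f0r w : f w 0 = 0.
  by have := fr w (- 1) 0 0; rewrite scaler0 add0r scaleN1r addNr.
have sumhom c w (F : Gamma -> V -> W) : w \in gV c -> (forall d, F d 0 = 0) ->
    \sum_(d <- gsupp gV w) F d (gcomp gV w d) = F c w.
  move=> wc F0; have cs := gcomp_hom wc.
  rewrite (eq_bigr (fun d => if d == c then F c w else 0)); last first.
    by move=> d _; rewrite cs; case: eqP => [->|].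
  rewrite -big_mkcond -big_filter.
  have [cw|cw] := boolP (c \in gsupp gV w).
    by rewrite filter_pred1_uniq ?gsupp_uniq// big_seq1.
  have w0 : w = 0 by move: (cs c); rewrite eqxx /gcomp (negPf cw).
  have -> : F c w = 0 by rewrite w0 F0.
  by rewrite big1.
rewrite /color_ext (sumhom a u (fun c x => \sum_(d <- gsupp gV v)
  eps c d *: f x (gcomp gV v d)))//; last first.
  by move=> d; rewrite big1// => e _; rewrite f0l scaler0.
by rewrite (sumhom b v (fun d y => eps a d *: f u y))// => d; rewrite f0r scaler0.
Qed.

End GradedMaps.

(* The inverse of a bijective map f, made total. *)
Definition inv_map (K : fieldType) (V : lmodType K) (f : V -> V) : V -> V :=
  'pinv_(fun=> 0) setT f.

Lemma inv_mapK (K : fieldType) (V : lmodType K) (f : V -> V) :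
  bijective f -> cancel f (inv_map f) /\ cancel (inv_map f) f.
Proof.
case=> h fK hK; have fI := can_inj fK; split => x.
  by apply: (pinvKV (fun=> 0) (A := setT)); [exact: in2W | rewrite inE].
by apply: (pinvK (fun=> 0) (A := setT)); rewrite inE; exists (h x).
Qed.

Section Algebras.
Variables (K : fieldType) (Gamma : zmodType) (g : lmodType K).
Variable gr : grading Gamma g.

Record bihom_assoc_color (mu : g -> g -> g) (al be : {linear g -> g}) : Prop :=
  BihomAssocColor {
  bha_mu : even_bilinear gr gr gr mu;
  bha_al : even_map gr gr al;
  bha_be : even_map gr gr be;
  bha_comm : forall x, al (be x) = be (al x);
  bha_al_mu : forall a b x y, x \in gr a -> y \in gr b ->
    al (mu x y) = mu (al x) (al y);
  bha_be_mu : forall a b x y, x \in gr a -> y \in gr b ->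
    be (mu x y) = mu (be x) (be y);
  bha_assoc : forall a b c x y z, x \in gr a -> y \in gr b -> z \in gr c ->
    mu (al x) (mu y z) = mu (mu x y) (be z)
}.

Variable eps : bicharacter K Gamma.

Record bihom3_lie_color (br : g -> g -> g -> g) (al be : {linear g -> g}) :
    Prop := Bihom3LieColor {
  bhl_br : even_trilinear gr gr gr gr br;
  bhl_al : even_map gr gr al;
  bhl_be : even_map gr gr be;
  bhl_skew12 : forall a b c x y z, x \in gr a -> y \in gr b -> z \in gr c ->
    br (be x) (be y) (al z) = - (eps a b *: br (be y) (be x) (al z));
  bhl_skew23 : forall a b c x y z, x \in gr a -> y \in gr b -> z \in gr c ->
    br (be x) (be y) (al z) = - (eps b c *: br (be x) (be z) (al y));
  bhl_jacobi : forall a b c d e x y z u v,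
    x \in gr a -> y \in gr b -> z \in gr c -> u \in gr d -> v \in gr e ->
    br (be (be x)) (be (be y)) (br (be z) (be u) (al v)) =
      eps (a + b + c) (d + e) *:
        br (be (be u)) (be (be v)) (br (be x) (be y) (al z))
      - (eps (a + b) (c + e) * eps d e) *:
        br (be (be z)) (be (be v)) (br (be x) (be y) (al u))
      + eps (a + b) (c + d) *:
        br (be (be z)) (be (be u)) (br (be x) (be y) (al v))
}.

Record nc_bihom3_poisson_color (br : g -> g -> g -> g) (mu : g -> g -> g)
    (al be : {linear g -> g}) : Prop := NcBihom3PoissonColor {
  bhp_assoc : bihom_assoc_color mu al be;
  bhp_lie : bihom3_lie_color br al be;
  bhp_leibniz : forall a b c d x y z t,
    x \in gr a -> y \in gr b -> z \in gr c -> t \in gr d ->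
    br (al (be x)) (al (be y)) (mu z t) =
      mu (br (be x) (be y) z) (be t)
      + eps (a + b) c *: mu (be z) (br (al x) (al y) t)
}.

(* [br3C br al be a b c x y z] is the bracket [x, y, z]^C for x, y, z
   homogeneous of degrees a, b, c. *)
Definition br3C (br : g -> g -> g -> g) (al be : g -> g) (a b c : Gamma)
    (x y z : g) : g :=
  br x y z
  - eps b c *: br x (be (inv_map al z)) (al (inv_map be y))
  + eps a (b + c) *: br y (be (inv_map al z)) (al (inv_map be x)).

Record bihom3_prelie_color (br : g -> g -> g -> g) (al be : {linear g -> g}) :
    Prop := Bihom3PrelieColor {
  bpl_br : even_trilinear gr gr gr gr br;
  bpl_al : even_map gr gr al;
  bpl_be : even_map gr gr be;
  bpl_comm : forall x, al (be x) = be (al x);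
  bpl_al_bij : bijective al;
  bpl_be_bij : bijective be;
  bpl_al_br : forall a b c x y z, x \in gr a -> y \in gr b -> z \in gr c ->
    al (br x y z) = br (al x) (al y) (al z);
  bpl_be_br : forall a b c x y z, x \in gr a -> y \in gr b -> z \in gr c ->
    be (br x y z) = br (be x) (be y) (be z);
  bpl_skew : forall a b c x y z, x \in gr a -> y \in gr b -> z \in gr c ->
    br (be x) (be y) (al z) = - (eps a b *: br (be y) (be x) (al z));
  bpl_b : forall a1 a2 a3 a4 a5 x1 x2 x3 x4 x5,
    x1 \in gr a1 -> x2 \in gr a2 -> x3 \in gr a3 -> x4 \in gr a4 ->
    x5 \in gr a5 ->
    br (al (be x4)) (al (be x5)) (br x1 x2 x3) =
      br (br3C br al be a4 a5 a1 (be x4) (be x5) x1) (be x2) (be x3)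
      + eps (a4 + a5) a1 *:
        br (be x1) (br3C br al be a4 a5 a2 (be x4) (be x5) x2) (be x3)
      + eps (a4 + a5) (a1 + a2) *:
        br (be x1) (be x2) (br (al x4) (al x5) x3);
  bpl_c : forall a1 a2 a3 a4 a5 x1 x2 x3 x4 x5,
    x1 \in gr a1 -> x2 \in gr a2 -> x3 \in gr a3 -> x4 \in gr a4 ->
    x5 \in gr a5 ->
    br (br3C br al be a4 a5 a1 (be x4) (be x5) x1) (be x2) (be x3) =
      eps a4 (a1 + a5) *: br (al (be x5)) (be x1) (br (al x4) x2 x3)
      + eps (a4 + a5) a1 *: br (be x1) (al (be x4)) (br (al x5) x2 x3)
      + br (al (be x4)) (al (be x5)) (br x1 x2 x3)
}.

Record bihom_dendriform_color (prec succ : g -> g -> g)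
    (al be : {linear g -> g}) : Prop := BihomDendriformColor {
  bhd_prec : even_bilinear gr gr gr prec;
  bhd_succ : even_bilinear gr gr gr succ;
  bhd_al : even_map gr gr al;
  bhd_be : even_map gr gr be;
  bhd_comm : forall x, al (be x) = be (al x);
  bhd_al_prec : forall a b x y, x \in gr a -> y \in gr b ->
    al (prec x y) = prec (al x) (al y);
  bhd_al_succ : forall a b x y, x \in gr a -> y \in gr b ->
    al (succ x y) = succ (al x) (al y);
  bhd_be_prec : forall a b x y, x \in gr a -> y \in gr b ->
    be (prec x y) = prec (be x) (be y);
  bhd_be_succ : forall a b x y, x \in gr a -> y \in gr b ->
    be (succ x y) = succ (be x) (be y);
  bhd_1 : forall a b c x y z, x \in gr a -> y \in gr b -> z \in gr c ->
    prec (prec x y) (be z) = prec (al x) (prec y z + succ y z);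
  bhd_2 : forall a b c x y z, x \in gr a -> y \in gr b -> z \in gr c ->
    prec (succ x y) (be z) = succ (al x) (prec y z);
  bhd_3 : forall a b c x y z, x \in gr a -> y \in gr b -> z \in gr c ->
    succ (al x) (succ y z) = succ (prec x y + succ x y) (be z)
}.

Record nc_bihom3_prepoisson_color (br : g -> g -> g -> g)
    (prec succ : g -> g -> g) (al be : {linear g -> g}) : Prop :=
  NcBihom3PrepoissonColor {
  bpp_prelie : bihom3_prelie_color br al be;
  bpp_dend : bihom_dendriform_color prec succ al be;
  bpp_P1 : forall a b c d x y z t,
    x \in gr a -> y \in gr b -> z \in gr c -> t \in gr d ->
    br (al (be (be x))) (al (be (be y))) (prec z (al t))
    - prec (br (be (be x)) (be (be y)) z) (al (be t)) =
      eps (a + b) c *: prec (be z)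
        (br (al (be x)) (al (be y)) (al t)
         - eps b d *: br (al (be x)) (be t) (al (al y))
         + eps a (b + d) *: br (al (be y)) (be t) (al (al x)));
  bpp_P2 : forall a b c d x y z t,
    x \in gr a -> y \in gr b -> z \in gr c -> t \in gr d ->
    br (al (be x)) (al (al (be y))) (succ (al z) t)
    - eps (a + b) c *: succ (al (be z)) (br (al x) (al (al y)) t) =
      succ
        (br (be x) (al (be y)) (al z)
         - eps b c *: br (be x) (be z) (al (al y))
         + eps a (b + c) *: br (al (be y)) (be z) (al x))
        (be t);
  bpp_P3 : forall a b c d x y z t,
    x \in gr a -> y \in gr b -> z \in gr c -> t \in gr d ->
    br (al (be x)) (be (prec y z)) (al (al (be t)))
    + br (al (be x)) (be (succ y z)) (al (al (be t))) =
      eps a b *: succ (al (be y)) (br (al x) (be z) (al (al t)))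
      + eps c d *: prec (br (be x) (be y) (al (be t))) (al (be z))
}.

End Algebras.

(* Maps g -> End(V) and g x g -> End(V) are curried. *)
Section Representations.
Variables (K : fieldType) (Gamma : zmodType) (g V : lmodType K).
Variables (gr : grading Gamma g) (gV : grading Gamma V).
Variable eps : bicharacter K Gamma.

Record bihom_assoc_bimodule (mu : g -> g -> g) (al be : {linear g -> g})
    (l r : g -> V -> V) (alV beV : {linear V -> V}) : Prop :=
  BihomAssocBimodule {
  bmd_l : even_bilinear gr gV gV l;
  bmd_r : even_bilinear gr gV gV r;
  bmd_al : even_map gV gV alV;
  bmd_be : even_map gV gV beV;
  bmd_comm : forall u, alV (beV u) = beV (alV u);
  bmd_al_l : forall a b x u, x \in gr a -> u \in gV b ->
    alV (l x u) = l (al x) (alV u);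
  bmd_be_l : forall a b x u, x \in gr a -> u \in gV b ->
    beV (l x u) = l (be x) (beV u);
  bmd_al_r : forall a b x u, x \in gr a -> u \in gV b ->
    alV (r x u) = r (al x) (alV u);
  bmd_be_r : forall a b x u, x \in gr a -> u \in gV b ->
    beV (r x u) = r (be x) (beV u);
  bmd_ll : forall a b c x y v, x \in gr a -> y \in gr b -> v \in gV c ->
    l (al x) (l y v) = l (mu x y) (beV v);
  bmd_lr : forall a b c x y v, x \in gr a -> y \in gr b -> v \in gV c ->
    l (al x) (r y v) = eps a b *: r (be y) (l x v);
  bmd_rr : forall a b c x y v, x \in gr a -> y \in gr b -> v \in gV c ->
    r (mu x y) (alV v) = eps a b *: r (be y) (r x v)
}.

Record bihom3_lie_rep (br : g -> g -> g -> g) (al be : {linear g -> g})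
    (rho : g -> g -> V -> V) (alV beV : {linear V -> V}) : Prop :=
  Bihom3LieRep {
  rep_rho : even_trilinear gr gr gV gV rho;
  rep_al : even_map gV gV alV;
  rep_be : even_map gV gV beV;
  rep_comm : forall w, alV (beV w) = beV (alV w);
  rep_skew : forall a b x y w, x \in gr a -> y \in gr b ->
    rho x y w = - (eps a b *: rho y x w);
  rep_1 : forall a b u v w, u \in gr a -> v \in gr b ->
    rho (al u) (al v) (alV w) = alV (rho u v w);
  rep_2 : forall a b u v w, u \in gr a -> v \in gr b ->
    rho (be u) (be v) (beV w) = beV (rho u v w);
  rep_3 : forall a b c d u v x y w,
    u \in gr a -> v \in gr b -> x \in gr c -> y \in gr d ->
    rho (al (be u)) (al (be v)) (rho x y w) =
      eps (a + b) (c + d) *: rho (be x) (be y) (rho (al u) (al v) w)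
      + rho (br (be u) (be v) x) (be y) (beV w)
      + eps (a + b) c *: rho (be x) (br (be u) (be v) y) (beV w);
  rep_4 : forall a b c d u v x y w,
    u \in gr a -> v \in gr b -> x \in gr c -> y \in gr d ->
    rho (br (be u) (be v) x) (be y) (beV w) =
      eps a (c + b) *: rho (al (be v)) (be x) (rho (al u) y w)
      + eps (a + b) c *: rho (be x) (al (be u)) (rho (al v) y w)
      + rho (al (be u)) (al (be v)) (rho x y w)
}.

Record nc_bihom3_poisson_rep (br : g -> g -> g -> g) (mu : g -> g -> g)
    (al be : {linear g -> g}) (rho : g -> g -> V -> V) (l r : g -> V -> V)
    (alV beV : {linear V -> V}) : Prop := NcBihom3PoissonRep {
  prp_bimodule : bihom_assoc_bimodule mu al be l r alV beV;
  prp_rep : bihom3_lie_rep br al be rho alV beV;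
  prp_l : forall a b c x y z w, x \in gr a -> y \in gr b -> z \in gr c ->
    rho (al (be x)) (al (be y)) (l z w) =
      l (br (be x) (be y) z) (beV w)
      + eps (a + b) c *: l (be z) (rho (al x) (al y) w);
  prp_r : forall a b c x y z w, x \in gr a -> y \in gr b -> z \in gr c ->
    rho (al (be x)) (al (be y)) (r z w) =
      eps (a + b) c *: r (be z) (rho (be x) (be y) w)
      + r (br (al x) (al y) z) (beV w);
  prp_mu : forall a b c x y z w, x \in gr a -> y \in gr b -> z \in gr c ->
    rho (al (be x)) (mu (be y) (be z)) (alV (alV (beV w))) =
      eps (a + b) c *: r (al (be z)) (rho (be x) (be y) (alV (beV w)))
      + eps a b *: l (al (be y)) (rho (al x) (be z) (alV (alV w)))
}.

Record kupershmidt (br : g -> g -> g -> g) (mu : g -> g -> g)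
    (al be : {linear g -> g}) (rho : g -> g -> V -> V) (l r : g -> V -> V)
    (alV beV : {linear V -> V}) (T : {linear V -> g}) : Prop := Kupershmidt {
  kup_al_bij : bijective alV;
  kup_be_bij : bijective beV;
  kup_even : even_map gV gr T;
  kup_al : forall u, T (alV u) = al (T u);
  kup_be : forall u, T (beV u) = be (T u);
  kup_mu : forall a b u v, u \in gV a -> v \in gV b ->
    mu (T u) (T v) = T (l (T u) v + eps a b *: r (T v) u);
  kup_br : forall a b c u v w, u \in gV a -> v \in gV b -> w \in gV c ->
    br (T u) (T v) (T w) =
      T (rho (T u) (T v) w
         - eps b c *:
           rho (T u) (T (inv_map alV (beV w))) (alV (inv_map beV v))
         + eps a (b + c) *:
           rho (T v) (T (inv_map alV (beV w))) (alV (inv_map beV u)))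
}.

Definition brV (rho : g -> g -> V -> V) (T : V -> g) (u v w : V) : V :=
  rho (T u) (T v) w.

Definition precV (r : g -> V -> V) (T : V -> g) : V -> V -> V :=
  color_ext gV eps (fun u v => r (T v) u).

Definition succV (l : g -> V -> V) (T : V -> g) (u v : V) : V := l (T u) v.

Lemma precV_hom (r : g -> V -> V) (T : {linear V -> g}) :
    even_bilinear gr gV gV r ->
  forall a b u v, u \in gV a -> v \in gV b ->
    precV r T u v = eps a b *: r (T v) u.
Proof.
case=> rl rr _; apply: color_ext_hom => [v c x y|u c x y].
  by rewrite rr.
by rewrite linearP rl.
Qed.

End Representations.

(* Main.v *)
Require Import Defs.
From HB Require Import structures.
From mathcomp Require Import all_boot all_order all_algebra.
From mathcomp Require Import boolp classical_sets functions.

Set Implicit Arguments.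
Unset Strict Implicit.
Unset Printing Implicit Defensive.

Import GRing.Theory.
Local Open Scope ring_scope.

(** The Kupershmidt equations say that [T] turns the sum [prec + succ] into
    [mu] and the bracket [[x, y, z]^C] into [br (T x) (T y) (T z)].  After these
    substitutions every axiom of a pre-Poisson color algebra on [V] is a
    representation axiom evaluated at elements [T x], the signs matching because
    [eps a b * eps b a = 1].  Since [precV] is defined through homogeneous
    components, its bilinearity rests on the uniqueness of these components. *)

(** * Linearity of homogeneous components and of color extensions *)

Section Graded.
Variables (K : fieldType) (Gamma : zmodType) (V : lmodType K).
Variable gr : grading Gamma V.

Lemma gpart0 a : 0 \in gr a.
Proof. by have [] := gpart_submod gr a. Qed.

Lemma gpartZD a k u v : u \in gr a -> v \in gr a -> k *: u + v \in gr a.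
Proof. by move=> ua va; have [_ +] := gpart_submod gr a; apply. Qed.

Lemma gpartZ a k u : u \in gr a -> k *: u \in gr a.
Proof. by move=> ua; rewrite -[_ *: _]addr0 gpartZD ?gpart0. Qed.

Lemma gpartD a u v : u \in gr a -> v \in gr a -> u + v \in gr a.
Proof. by move=> ua va; rewrite -[u]scale1r gpartZD. Qed.

Lemma gpartB a u v : u \in gr a -> v \in gr a -> u - v \in gr a.
Proof. by move=> ua va; rewrite addrC -scaleN1r gpartZD. Qed.

(** The list [gsupp gr v] comes from a choice made separately for each [v], so sums for different
    vectors can only be compared over a common list [s]. Components outside the support are zero,
    hence the added terms are [F a 0 = 0]. *)
Lemma sum_gsupp_widen (W : zmodType) (F : Gamma -> V -> W) (v : V)
    (s : seq Gamma) :
    (forall a, F a 0 = 0) -> uniq s -> {subset gsupp gr v <= s} ->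
  \sum_(a <- gsupp gr v) F a (gcomp gr v a) = \sum_(a <- s) F a (gcomp gr v a).
Proof.
move=> F0 us vs; rewrite [RHS](bigID (mem (gsupp gr v)))/= [X in _ + X]big1.
  rewrite addr0 -[RHS]big_filter; apply: perm_big; apply: uniq_perm.
  - exact: gsupp_uniq.
  - by rewrite filter_uniq.
  - by move=> a; rewrite mem_filter andb_idr //; exact: vs.
by move=> a /negPf av; rewrite /gcomp av F0.
Qed.

(** The chosen decompositions of [k *: u + v], [u] and [v] are unrelated a priori. Their discrepancy
    is a family of homogeneous elements with sum zero, so [gpart_free] forces each member to
    vanish. *)
Lemma gcomp_linear a : linear (gcomp gr ^~ a).
Proof.
move=> k u v.
(* Including [a] lets freeness be read off at [a] even when [a] lies in none of the three
   supports. *)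
set s := undup (a :: gsupp gr (k *: u + v) ++ gsupp gr u ++ gsupp gr v).
have us : uniq s by rewrite undup_uniq.
have sumE w : {subset gsupp gr w <= s} -> \sum_(b <- s) gcomp gr w b = w.
  by move=> ws; rewrite -(sum_gsupp_widen (F := fun=> id))// -gcomp_sum.
pose f b := gcomp gr (k *: u + v) b - (k *: gcomp gr u b + gcomp gr v b).
have fin b : f b \in gr b.
  by apply: gpartB; [|apply: gpartZD]; exact: gcomp_in.
have f0 : \sum_(b <- s) f b = 0.
  rewrite sumrB big_split/= -scaler_sumr !sumE ?subrr// => b bs;
  by rewrite mem_undup inE !mem_cat bs ?orbT.
have as_ : a \in s by rewrite mem_undup mem_head.
by have /eqP := gpart_free us fin f0 as_; rewrite subr_eq0 => /eqP.
Qed.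

Lemma linear_eq0 (W : lmodType K) (f : V -> W) : linear f -> f 0 = 0.
Proof.
by move=> fl; have := fl (- 1) 0 0; rewrite scaler0 add0r scaleN1r addNr.
Qed.

Lemma linear_sum_gsupp (W : lmodType K) (F : Gamma -> V -> W) :
    (forall a, linear (F a)) ->
  linear (fun v => \sum_(a <- gsupp gr v) F a (gcomp gr v a)).
Proof.
move=> Fl k u v.
have F0 a : F a 0 = 0 by exact: linear_eq0.
set s := undup (gsupp gr (k *: u + v) ++ gsupp gr u ++ gsupp gr v).
have us : uniq s by rewrite undup_uniq.
rewrite !(sum_gsupp_widen (s := s))//;
  try by move=> b bs; rewrite mem_undup !mem_cat bs ?orbT.
rewrite scaler_sumr -big_split/=; apply: eq_bigr => a _.
by rewrite gcomp_linear Fl.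
Qed.

Lemma linear_sum (W : lmodType K) (s : seq Gamma) (F : Gamma -> V -> W) :
  (forall a, linear (F a)) -> linear (fun v => \sum_(a <- s) F a v).
Proof.
move=> Fl k u v; rewrite scaler_sumr -big_split/=; apply: eq_bigr => a _.
exact: Fl.
Qed.

Lemma linear_scale (W : lmodType K) (c : K) (f : V -> W) :
  linear f -> linear (fun v => c *: f v).
Proof. by move=> fl k u v; rewrite fl scalerDr !scalerA mulrC. Qed.

Lemma color_ext_linearl (W : lmodType K) (eps : bicharacter K Gamma)
    (f : V -> V -> W) (v : V) :
  (forall w, linear (f^~ w)) -> linear (color_ext gr eps f ^~ v).
Proof.
move=> fl; apply: (@linear_sum_gsupp W (fun a x =>
  \sum_(b <- gsupp gr v) eps a b *: f x (gcomp gr v b))) => a.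
apply: (@linear_sum W _ (fun b x => eps a b *: f x (gcomp gr v b))) => b.
exact: (@linear_scale W _ (f^~ _)).
Qed.

Lemma color_ext_linearr (W : lmodType K) (eps : bicharacter K Gamma)
    (f : V -> V -> W) (u : V) :
  (forall w, linear (f w)) -> linear (color_ext gr eps f u).
Proof.
(* With [u] fixed the outer index list is constant; only the inner list varies with the argument. *)
move=> fl; apply: (@linear_sum W _ (fun a y =>
  \sum_(b <- gsupp gr y) eps a b *: f (gcomp gr u a) (gcomp gr y b))) => a.
apply: (@linear_sum_gsupp W (fun b y => eps a b *: f (gcomp gr u a) y)) => b.
exact: linear_scale.
Qed.

End Graded.

(** This reconciles [inv_map alV (beV w)] in the Kupershmidt equation with [beV (inv_map alV w)] in
    [br3C]. *)
Lemma inv_map_comm (K : fieldType) (V : lmodType K) (f h : V -> V) :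
    bijective f -> (forall x, f (h x) = h (f x)) ->
  forall x, inv_map f (h x) = h (inv_map f x).
Proof.
move=> /inv_mapK[fK finvK] fh x.
by apply: (can_inj fK); rewrite finvK fh finvK.
Qed.

Section KupershmidtPrePoisson.
Variables (K : fieldType) (Gamma : zmodType) (eps : bicharacter K Gamma).
Variables (g V : lmodType K) (gr : grading Gamma g) (gV : grading Gamma V).
Variables (br : g -> g -> g -> g) (mu : g -> g -> g) (al be : {linear g -> g}).
Variables (rho : g -> g -> V -> V) (l r : g -> V -> V).
Variables (alV beV : {linear V -> V}) (T : {linear V -> g}).
Hypothesis Hg : nc_bihom3_poisson_color gr eps br mu al be.
Hypothesis Hrep : nc_bihom3_poisson_rep gr gV eps br mu al be rho l r alV beV.
Hypothesis HT : kupershmidt gr gV eps br mu al be rho l r alV beV T.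

Let Hbm := prp_bimodule Hrep.
Let Hrho := prp_rep Hrep.
Let Tin := kup_even HT.
Let alin := bmd_al Hbm.
Let bein := bmd_be Hbm.
Let alVbeV := bmd_comm Hbm.
Let albe := bha_comm (bhp_assoc Hg).
Let Tal := kup_al HT.
Let Tbe := kup_be HT.

(** * Multilinearity and degrees of the induced operations, and their images under [T] *)

Lemma brV_even a b c u v w : u \in gV a -> v \in gV b -> w \in gV c ->
  brV rho T u v w \in gV (a + b + c).
Proof.
by move=> ua vb wc; case: (rep_rho Hrho) => _ _ _; apply => //; exact: Tin.
Qed.

Lemma brV_trilinear : even_trilinear gV gV gV gV (brV rho T).
Proof.
case: (rep_rho Hrho) => rl1 rl2 rl3 _; split.
- by move=> y z k u v; rewrite /brV linearP rl1.
- by move=> x z k u v; rewrite /brV linearP rl2.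
- by move=> x y; exact: rl3.
- exact: brV_even.
Qed.

Lemma precVE a b u v : u \in gV a -> v \in gV b ->
  precV gV eps r T u v = eps a b *: r (T v) u.
Proof. exact: precV_hom (bmd_r Hbm) _ _ _ _. Qed.

Lemma precV_bilinear : even_bilinear gV gV gV (precV gV eps r T).
Proof.
have [rl rr re] := bmd_r Hbm; split.
- by move=> v; apply: color_ext_linearl => w k x y; rewrite rr.
- by move=> v; apply: color_ext_linearr => w k x y; rewrite linearP rl.
- move=> a b x y xa yb; rewrite (precVE xa yb) gpartZ// addrC.
  by apply: re => //; exact: Tin.
Qed.

Lemma succV_bilinear : even_bilinear gV gV gV (succV l T).
Proof.
have [ll lr le] := bmd_l Hbm; split.
- by move=> v k x y; rewrite /succV linearP ll.
- by move=> u; exact: lr.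
- by move=> a b x y xa yb; apply: le => //; exact: Tin.
Qed.

Lemma kup_mu_dend a b u v : u \in gV a -> v \in gV b ->
  T (precV gV eps r T u v + succV l T u v) = mu (T u) (T v).
Proof. by move=> ua vb; rewrite (kup_mu HT ua vb) (precVE ua vb) addrC. Qed.

Lemma kup_br3C a b c u v w : u \in gV a -> v \in gV b -> w \in gV c ->
  T (br3C eps (brV rho T) alV beV a b c u v w) = br (T u) (T v) (T w).
Proof.
move=> ua vb wc; rewrite (kup_br HT ua vb wc) /br3C /brV.
by rewrite !(inv_map_comm (kup_al_bij HT) alVbeV).
Qed.

(** With twists [beV], [beV], [alV] on the arguments, all inverses in the Kupershmidt equation
    cancel. This is the inverse-free shape of the brackets in (P1) and (P2). *)
Lemma kup_br_be a b c u v w : u \in gV a -> v \in gV b -> w \in gV c ->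
  br (T (beV u)) (T (beV v)) (T (alV w)) =
    T (rho (T (beV u)) (T (beV v)) (alV w)
       - eps b c *: rho (T (beV u)) (T (beV w)) (alV v)
       + eps a (b + c) *: rho (T (beV v)) (T (beV w)) (alV u)).
Proof.
move=> ua vb wc; have [aK _] := inv_mapK (kup_al_bij HT).
have [bK _] := inv_mapK (kup_be_bij HT).
by rewrite (kup_br HT (bein ua) (bein vb) (alin wc)) -alVbeV aK !bK.
Qed.

(** * The pre-Lie and dendriform axioms *)

Lemma brV_prelie : bihom3_prelie_color gV eps (brV rho T) alV beV.
Proof.
split=> //.
- exact: brV_trilinear.
- exact: kup_al_bij HT.
- exact: kup_be_bij HT.
- move=> a b c x y z xa yb zc.
  by rewrite /brV !Tal (rep_1 Hrho _ (Tin xa) (Tin yb)).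
- move=> a b c x y z xa yb zc.
  by rewrite /brV !Tbe (rep_2 Hrho _ (Tin xa) (Tin yb)).
- move=> a b c x y z xa yb _.
  exact: (rep_skew Hrho _ (Tin (bein xa)) (Tin (bein yb))).
- move=> a1 a2 a3 a4 a5 x1 x2 x3 x4 x5 h1 h2 h3 h4 h5.
  rewrite /brV (kup_br3C (bein h4) (bein h5) h1).
  rewrite (kup_br3C (bein h4) (bein h5) h2) !(Tal, Tbe).
  rewrite (rep_3 Hrho _ (Tin h4) (Tin h5) (Tin h1) (Tin h2)).
  (* The iterated action comes first in [rep_3] and last in axiom (b). *)
  by rewrite -addrA addrC.
- move=> a1 a2 a3 a4 a5 x1 x2 x3 x4 x5 h1 h2 h3 h4 h5.
  rewrite /brV (kup_br3C (bein h4) (bein h5) h1) !(Tal, Tbe).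
  exact: (rep_4 Hrho _ (Tin h4) (Tin h5) (Tin h1) (Tin h2)).
Qed.

(** The three dendriform axioms are, in order, the bimodule laws [bmd_rr], [bmd_lr] and [bmd_ll],
    since [T] sends the sum of the two products to [mu]. *)
Lemma precV_succV_dendriform :
  bihom_dendriform_color gV (precV gV eps r T) (succV l T) alV beV.
Proof.
have [_ pr pe] := precV_bilinear.
have [_ sr se] := succV_bilinear.
have [rl rr re] := bmd_r Hbm.
have [ll lr le] := bmd_l Hbm.
have rZ x k u : r x (k *: u) = k *: r x u.
  by rewrite -[k *: u]addr0 rr (linear_eq0 (rr _)) addr0.
have lZ x k u : l x (k *: u) = k *: l x u.
  by rewrite -[k *: u]addr0 lr (linear_eq0 (lr _)) addr0.
split=> //.
- exact: precV_bilinear.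
- exact: succV_bilinear.
- move=> a b x y xa yb; rewrite (precVE xa yb) (precVE (alin xa) (alin yb)).
  by rewrite linearZ/= (bmd_al_r Hbm (Tin yb) xa) Tal.
- by move=> a b x y xa yb; rewrite /succV (bmd_al_l Hbm (Tin xa) yb) Tal.
- move=> a b x y xa yb; rewrite (precVE xa yb) (precVE (bein xa) (bein yb)).
  by rewrite linearZ/= (bmd_be_r Hbm (Tin yb) xa) Tbe.
- by move=> a b x y xa yb; rewrite /succV (bmd_be_l Hbm (Tin xa) yb) Tbe.
- move=> a b c x y z xa yb zc.
  (* The formula [precVE] needs homogeneous arguments, so the sum of both products must be seen to
     have degree [b + c]. *)
  have yzin := gpartD (pe _ _ _ _ yb zc) (se _ _ _ _ yb zc).
  rewrite (precVE (pe _ _ _ _ xa yb) (bein zc)) (precVE (alin xa) yzin).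
  rewrite (kup_mu_dend yb zc) (precVE xa yb) rZ scalerA Tbe.
  (* Both scalars expand to the product of [eps a b], [eps a c] and [eps b c]. *)
  rewrite (bmd_rr Hbm (Tin yb) (Tin zc) xa) scalerA bicharDl bicharDr.
  by rewrite mulrC mulrA.
- move=> a b c x y z xa yb zc.
  rewrite (precVE (se _ _ _ _ xa yb) (bein zc)) (precVE yb zc) /succV lZ.
  rewrite Tal Tbe (bmd_lr Hbm (Tin xa) (Tin zc) yb) scalerA bicharDl.
  by rewrite mulrC.
- move=> a b c x y z xa yb zc.
  rewrite /succV (kup_mu_dend xa yb) Tal.
  exact: (bmd_ll Hbm (Tin xa) (Tin yb) zc).
Qed.

(** * The compatibility identities (P1), (P2) and (P3) *)

Lemma prePoisson_P1 a b c d x y z t :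
    x \in gV a -> y \in gV b -> z \in gV c -> t \in gV d ->
  brV rho T (alV (beV (beV x))) (alV (beV (beV y)))
    (precV gV eps r T z (alV t))
  - precV gV eps r T (brV rho T (beV (beV x)) (beV (beV y)) z)
      (alV (beV t)) =
  eps (a + b) c *: precV gV eps r T (beV z)
    (brV rho T (alV (beV x)) (alV (beV y)) (alV t)
     - eps b d *: brV rho T (alV (beV x)) (beV t) (alV (alV y))
     + eps a (b + d) *: brV rho T (alV (beV y)) (beV t) (alV (alV x))).
Proof.
move=> xa yb zc td.
have [_ _ rl3 _] := rep_rho Hrho.
have rhoZ X Y k u : rho X Y (k *: u) = k *: rho X Y u.
  by rewrite -[k *: u]addr0 rl3 (linear_eq0 (rl3 _ _)) addr0.
have TE := kup_br_be (alin xa) (alin yb) td; rewrite -!alVbeV in TE.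
(* [W] is the vector whose image under [T] is the bracket in [TE]; its homogeneity allows [precVE]
   to expand the outer product. *)
set W := (X in precV gV eps r T (beV z) X).
have Win : W \in gV (a + b + d).
  apply: gpartD; first apply: gpartB; first by apply: brV_even; auto.
    by rewrite addrAC; apply/gpartZ/brV_even; auto.
  by rewrite -addrA addrC; apply/gpartZ/brV_even; auto.
rewrite (precVE (bein zc) Win) (precVE zc (alin td)).
rewrite (precVE (brV_even (bein (bein xa)) (bein (bein yb)) zc)
  (alin (bein td))).
rewrite -TE /brV rhoZ !(Tal, Tbe).
(* The extra [beV] on [x], [y] and [alV] on [t] match the twists of (P1). The first summand of
   [prp_r] cancels the subtracted term, leaving the action of [T W] on [beV z]. *)
have := prp_r Hrep z (Tin (bein xa)) (Tin (bein yb)) (Tin (alin td)).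
rewrite !(Tal, Tbe, albe) => ->; rewrite scalerDr !scalerA.
have -> : eps c d * eps (a + b) d = eps (a + b + c) d.
  by rewrite [eps (_ + c) _]bicharDl mulrC.
rewrite [LHS]addrAC subrr add0r; congr (_ *: _).
rewrite bicharDr mulrA.
have -> : eps (a + b) c * eps c (a + b) = 1 by exact: bichar_skew.
by rewrite mul1r.
Qed.

Lemma prePoisson_P2 a b c d x y z t :
    x \in gV a -> y \in gV b -> z \in gV c -> t \in gV d ->
  brV rho T (alV (beV x)) (alV (alV (beV y))) (succV l T (alV z) t)
  - eps (a + b) c *:
    succV l T (alV (beV z)) (brV rho T (alV x) (alV (alV y)) t) =
  succV l T
    (brV rho T (beV x) (alV (beV y)) (alV z)
     - eps b c *: brV rho T (beV x) (beV z) (alV (alV y))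
     + eps a (b + c) *: brV rho T (alV (beV y)) (beV z) (alV x))
    (beV t).
Proof.
move=> xa yb zc td.
have TE := kup_br_be xa (alin yb) zc; rewrite -!alVbeV in TE.
rewrite /succV /brV -TE !(Tal, Tbe).
(* Only [y] and [z] carry an extra [alV]. The second summand of [prp_l] is the term subtracted in
   (P2). *)
have := prp_l Hrep t (Tin xa) (Tin (alin yb)) (Tin (alin zc)).
by rewrite !(Tal, Tbe, albe) => ->; rewrite addrK.
Qed.

Lemma prePoisson_P3 a b c d x y z t :
    x \in gV a -> y \in gV b -> z \in gV c -> t \in gV d ->
  brV rho T (alV (beV x)) (beV (precV gV eps r T y z)) (alV (alV (beV t)))
  + brV rho T (alV (beV x)) (beV (succV l T y z)) (alV (alV (beV t))) =
  eps a b *: succV l T (alV (beV y)) (brV rho T (alV x) (beV z) (alV (alV t)))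
  + eps c d *: precV gV eps r T (brV rho T (beV x) (beV y) (alV (beV t)))
      (alV (beV z)).
Proof.
move=> xa yb zc td.
have [_ rl2 _ _] := rep_rho Hrho.
(* Merging the two terms puts the sum of both products in the middle slot, where [T] turns it into
   [mu]. *)
have -> u p q w : brV rho T u p w + brV rho T u q w = brV rho T u (p + q) w.
  by rewrite /brV linearD; have := rl2 (T u) w 1 (T p) (T q); rewrite !scale1r.
rewrite -linearD (precVE (brV_even (bein xa) (bein yb) (alin (bein td)))
  (alin (bein zc))) /brV !(Tal, Tbe) (kup_mu_dend yb zc).
rewrite (bha_be_mu (bhp_assoc Hg) (Tin yb) (Tin zc)) /succV !(Tal, Tbe).
rewrite (prp_mu Hrep t (Tin xa) (Tin yb) (Tin zc)) addrC scalerA.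
(* Expanding the product [precV] contributes [eps (a + b + d) c], whose factor [eps d c] cancels the
   prefactor [eps c d]. *)
by rewrite [eps (_ + d) _]bicharDl [_ * eps d c]mulrC mulrA bichar_skew mul1r.
Qed.

End KupershmidtPrePoisson.

Theorem theorem4p11 (K : closedFieldType) (hK : [pchar K] =i pred0)
    (Gamma : zmodType) (eps : bicharacter K Gamma)
    (g V : lmodType K) (gr : grading Gamma g) (gV : grading Gamma V)
    (br : g -> g -> g -> g) (mu : g -> g -> g) (al be : {linear g -> g})
    (rho : g -> g -> V -> V) (l r : g -> V -> V) (alV beV : {linear V -> V})
    (T : {linear V -> g}) :
  nc_bihom3_poisson_color gr eps br mu al be ->
  nc_bihom3_poisson_rep gr gV eps br mu al be rho l r alV beV ->
  kupershmidt gr gV eps br mu al be rho l r alV beV T ->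
  nc_bihom3_prepoisson_color gV eps
    (brV rho T) (precV gV eps r T) (succV l T) alV beV.
Proof.
move=> Hg Hrep HT; split.
- exact: brV_prelie Hrep HT.
- exact: precV_succV_dendriform Hrep HT.
- exact: (prePoisson_P1 Hg Hrep HT).
- exact: (prePoisson_P2 Hg Hrep HT).
- exact: (prePoisson_P3 Hg Hrep HT).
Qed.
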